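(* Let $G=(V,E)$ be a finite graph. Then the rank of $A^c$ equals the height of $\mathrm{Fl}\,G$, i.e. the maximum number of independent columns of $A^c$ equals $\mathrm{ht}\,\mathrm{Fl}\,G$.
   Context: Graphs are finite, undirected, without loops or multiple edges. For $v\in V$, $\mathrm{St}(v)$ is the set of vertices adjacent to $v$; for $W\subseteq V$, $\mathrm{St}(W)=\bigcap_{w\in W}\mathrm{St}(w)$, with $\mathrm{St}(\emptyset)=V$. $\mathrm{Fl}\,G=\{\mathrm{St}(W)\mid W\subseteq V\}$ ordered by inclusion. The height of a finite poset is the maximum $k$ such that it contains a chain $p_0<\dots<p_k$. $A^c$ is the $V\times V$ boolean matrix with $(i,j)$ entry $0$ if $\{i,j\}\in E$ and $1$ otherwise. The superboolean semiring $\mathbb{SB}=\{0,1,1^\nu\}$ has addition $0+x=x$, $1+1=1^\nu$, $1^\nu+x=1^\nu$, and multiplication $0\cdot x=0$, $1\cdot 1=1$, $1\cdot1^\nu=1^\nu\cdot1^\nu=1^\nu$. Vectors $C_1,\dots,C_m\in\mathbb{SB}^n$ are dependent if some combination $\sum\lambda_iC_i$ with $\lambda_i\in\{0,1\}$ not all zero has all coordinates in $\{0,1^\nu\}$; otherwise independent. The rank of a boolean matrix is the maximum number of independent columns. *)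

(* Defs.v *)
From HB Require Import structures.
From mathcomp Require Import all_boot all_order all_algebra.

Set Implicit Arguments.
Unset Strict Implicit.
Unset Printing Implicit Defensive.

(* [Order.DefaultSetSubsetOrder] orders [{set T}] by inclusion. *)
Import Order.TTheory GRing.Theory Order.DefaultSetSubsetOrder.

Local Open Scope ring_scope.

(* [SBnu] is the ghost element $1^\nu$. *)
Inductive SB : Type := SB0 | SB1 | SBnu.

Definition SB_add (x y : SB) : SB :=
  match x, y with
  | SB0, z | z, SB0 => z
  | _, _ => SBnu
  end.

Definition SB_mul (x y : SB) : SB :=
  match x, y with
  | SB0, _ | _, SB0 => SB0
  | SB1, z | z, SB1 => z
  | SBnu, SBnu => SBnu
  end.

Definition option_of_SB (x : SB) : option bool :=
  match x with SB0 => None | SB1 => Some false | SBnu => Some true end.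

Definition SB_of_option (o : option bool) : SB :=
  match o with None => SB0 | Some false => SB1 | Some true => SBnu end.

Lemma option_of_SBK : cancel option_of_SB SB_of_option.
Proof. by case. Qed.

HB.instance Definition _ := Finite.copy SB (can_type option_of_SBK).

Lemma SB_addA : associative SB_add. Proof. by do 3![case]. Qed.
Lemma SB_addC : commutative SB_add. Proof. by do 2![case]. Qed.
Lemma SB_add0 : left_id SB0 SB_add. Proof. by case. Qed.

HB.instance Definition _ := GRing.isNmodule.Build SB SB_addA SB_addC SB_add0.

Lemma SB_mulA : associative SB_mul. Proof. by do 3![case]. Qed.
Lemma SB_mulC : commutative SB_mul. Proof. by do 2![case]. Qed.
Lemma SB_mul1 : left_id SB1 SB_mul. Proof. by case. Qed.
Lemma SB_mulDl : left_distributive SB_mul SB_add. Proof. by do 3![case]. Qed.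
Lemma SB_mul0 : left_zero SB0 SB_mul. Proof. by case. Qed.
Lemma SB_1neq0 : SB1 != SB0. Proof. by []. Qed.

HB.instance Definition _ := GRing.Nmodule_isComNzSemiRing.Build SB
  SB_mulA SB_mulC SB_mul1 SB_mulDl SB_mul0 SB_1neq0.

Definition SB_of_bool (b : bool) : SB := if b then 1 else 0.

(* The finite list of vectors is the subfamily of [C] indexed by [J]; the
   values of [lam] outside [J] are irrelevant. *)
Definition dependent (m n : nat) (C : 'I_n -> 'cV[SB]_m) (J : {set 'I_n}) : bool :=
  [exists lam : {ffun 'I_n -> SB},
    [&& [forall j in J, lam j \in [:: 0; 1]],
        [exists j in J, lam j != 0] &
        [forall i, (\sum_(j in J) lam j *: C j) i 0 \in [:: SB0; SBnu]]]].

Definition independent (m n : nat) (C : 'I_n -> 'cV[SB]_m) (J : {set 'I_n}) : bool :=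
  ~~ dependent C J.

Definition sb_rank (m n : nat) (M : 'M[bool]_(m, n)) : nat :=
  \max_(J : {set 'I_n} | independent (fun j => col j (map_mx SB_of_bool M)) J) #|J|.

Section Poset.

Context {d : Order.disp_t} {P : finPOrderType d}.

(* [F] carries the order induced from [P]. *)
Definition has_chain (F : {set P}) (k : nat) : bool :=
  [exists p : k.+1.-tuple P, all [in F] p && sorted <%O p].

Definition height (F : {set P}) : nat := \max_(k < #|F| | has_chain F k) k.

(* Hence the bound on [k] in [height] excludes no chain. *)
Lemma has_chain_ltn_card (F : {set P}) (k : nat) : has_chain F k -> (k < #|F|)%N.
Proof.
case/existsP=> p /andP[/allP pF sp].
have up : uniq p by exact: (sorted_uniq lt_trans ltxx).
by rewrite -{1}(size_tuple p) -(card_uniqP up); apply/subset_leq_card/subsetP.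
Qed.

End Poset.

Section Graph.

Variables (V : finType) (e : rel V).

Definition star (v : V) : {set V} := [set u | e v u].

(* The empty intersection is [setT]. *)
Definition Star (W : {set V}) : {set V} := \bigcap_(w in W) star w.

Definition Fl : {set {set V}} := [set Star W | W : {set V}].

Definition compl_adj : 'M[bool]_#|V| :=
  \matrix_(i, j) ~~ e (enum_val i) (enum_val j).

End Graph.

(* Main.v *)
(** Over the superboolean semiring a sum of [0]s and [1]s avoids [{0, 1^nu}]
    exactly when it has a single summand [1], so a set [J] of columns is
    independent iff every nonempty [K] in [J] has a row with exactly one [1] in
    [K].  For columns of [A^c] such a row [y] of [K], with its [1] in column
    [x], says that [y] lies in [St(K - x)] but not in [St(K)]; deleting [x] and
    iterating gives a chain of length [#|J|] in [Fl G].  Conversely, along a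
    chain [F_0 < ... < F_k] with [F_i = St(W_i)], vertices [y_i] in
    [F_i - F_(i-1)] and [x_i] in [W_(i-1)] not adjacent to [y_i] make the [x_i]
    index a triangular, hence independent, family of columns. *)
Require Import Defs.
From mathcomp Require Import all_boot all_order all_algebra.
Import Order.DefaultSetSubsetOrder.

Set Implicit Arguments.
Unset Strict Implicit.
Unset Printing Implicit Defensive.

(** Already [1 + 1] is [SBnu], which absorbs every further summand. *)
Lemma SB_natr_eq1 (n : nat) : ((n%:R)%R == SB1 :> SB) = (n == 1).
Proof.
case: n => [|[|n]] //; rewrite !GRing.mulrS.
by case: (_%:R)%R.
Qed.

Lemma SB_sum_eq1 (I : finType) (K : {set I}) (b : pred I) :
  (\sum_(j in K) SB_of_bool (b j) == SB1)%R = (#|[set j in K | b j]| == 1).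
Proof.
rewrite -SB_natr_eq1 -sum1_card GRing.natr_sum [in RHS]big_mkcond.
rewrite [in LHS]big_mkcond /=; congr (_ == _); apply: eq_bigr => j _.
by rewrite inE; case: (j \in K); case: (b j).
Qed.

(** Coefficients in [{0, 1}] on [J] amount to a subset [K] of [J], their support, and each
    coordinate of the combination then counts the ones of a row within [K]. *)
Lemma independentP (m n : nat) (M : 'M[bool]_(m, n)) (J : {set 'I_n}) :
  reflect (forall K : {set 'I_n}, K \subset J -> K != set0 ->
             exists i, #|[set j in K | M i j]| == 1)
          (independent (fun j => col j (map_mx SB_of_bool M)) J).
Proof.
have sumE (lam : 'I_n -> SB) (K : {set 'I_n}) i :
    K \subset J -> (forall j, j \in J -> lam j = SB_of_bool (j \in K)) ->
    ((\sum_(j in J) lam j *: col j (map_mx SB_of_bool M)) i 0 \in [:: SB0; SBnu])%R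
    = (#|[set j in K | M i j]| != 1).
  move=> sKJ lamE; rewrite -SB_sum_eq1 summxE.
  have -> : (\sum_(j in J) (lam j *: col j (map_mx SB_of_bool M)) i 0
             = \sum_(j in K) SB_of_bool (M i j))%R.
    rewrite (big_setID K) /= (setIidPr sKJ) [X in (_ + X)%R]big1 ?GRing.addr0.
      apply: eq_bigr => j jK; rewrite !mxE lamE ?(subsetP sKJ) // jK.
      exact: GRing.mul1r.
    move=> j /setDP[jJ jK]; rewrite !mxE lamE // (negbTE jK).
    exact: GRing.mul0r.
  by case: (\sum_(j in K) _)%R.
apply: (iffP idP) => [indJ K sKJ /set0Pn[k kK] | H].
  apply/existsP; apply: contraR indJ => /existsPn noi.
  apply/existsP; exists [ffun j => SB_of_bool (j \in K)]; apply/and3P; split.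
  - by apply/forall_inP => j jJ; rewrite ffunE; case: (j \in K).
  - by apply/existsP; exists k; rewrite (subsetP sKJ) // ffunE kK.
  - apply/forallP => i; rewrite (sumE _ K) ?noi // => j _.
    by rewrite ffunE.
apply/negP => /existsP[lam /and3P[/forall_inP lam01 lamN0 /forallP sum0]].
(* Restricting the support to [J] discards the arbitrary values of [lam] elsewhere. *)
pose K := [set j in J | lam j != 0%R].
have sKJ : K \subset J by apply/subsetP => j; rewrite inE => /andP[].
have [|i] := H K sKJ.
  case/existsP: lamN0 => k /andP[kJ lamk]; apply/set0Pn; exists k.
  by rewrite inE kJ.
apply/negP; rewrite -(sumE lam) // => j jJ; rewrite inE jJ.
by have := lam01 j jJ; case: (lam j).
Qed.

Lemma in_Star (V : finType) (e : rel V) (W : {set V}) (u : V) :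
  reflect (forall w, w \in W -> e w u) (u \in Star e W).
Proof. by apply: (iffP bigcapP) => H w /H; rewrite inE. Qed.

Lemma Star_in_Fl (V : finType) (e : rel V) (W : {set V}) : Star e W \in Fl e.
Proof. exact: imset_f. Qed.

Lemma has_chain_pathP (d : Order.disp_t) (P : finPOrderType d) (F : {set P})
  (k : nat) :
  reflect (exists x t, [/\ size t = k, all [in F] (x :: t) & path <%O x t]%O)
          (has_chain F k).
Proof.
apply: (iffP existsP) => [[p /andP[pF sp]] | [x [t [st tF pt]]]].
  case/tupleP: p pF sp => x t pF sp; exists x, t.
  by rewrite size_tuple.
have sxt : size (x :: t) == k.+1 by rewrite /= st.
by exists (Tuple sxt); apply/andP; split.
Qed.

Section ComplementRank.

Variables (V : finType) (e : rel V).
Hypothesis e_sym : symmetric e.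

Let columns := fun j => col j (map_mx SB_of_bool (compl_adj e)).

(** Fixing the bottom of the chain at the star of [J] makes the induction close: the chain for
    [J :\ x] starts at a larger star, so the star of [J] can be put below it. *)
Lemma independent_path (J : {set 'I_#|V|}) : independent columns J ->
  exists t : seq {set V}, [/\ size t = #|J|, all [in Fl e] t &
    path <%O (Star e (enum_val @: J)) t]%O.
Proof.
have [c] := ubnP #|J|; elim: c J => // c IH J leJc /independentP indJ.
have [->|J0] := eqVneq J set0; first by exists [::]; rewrite cards0.
have [i /cards1P[x rowi]] := indJ J (subxx _) J0.
have /andP[xJ nadj] : (x \in J) && ~~ e (enum_val i) (enum_val x).
  by have := set11 x; rewrite -rowi !inE mxE.
have [||t [st tF pt]] := IH (J :\ x).
- by move: leJc; rewrite (cardsD1 x) xJ.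
- apply/independentP => K sK; apply: indJ.
  exact: subset_trans sK (subD1set _ _).
exists (Star e (enum_val @: (J :\ x)) :: t); split.
- by rewrite /= st [in RHS](cardsD1 x) xJ.
- by rewrite /= Star_in_Fl.
rewrite /= pt andbT; change (Star e (enum_val @: J) \proper
  Star e (enum_val @: (J :\ x))).
apply/properP; split.
  apply/subsetP => u /in_Star Hu; apply/in_Star => w /imsetP[k kJ ->].
  by apply: Hu; apply: imset_f; case/setD1P: kJ.
(* Row [i] meets [J] only in column [x], so its vertex is adjacent to all of [J :\ x] but not to
   [x]. *)
exists (enum_val i).
  apply/in_Star => _ /imsetP[k /setD1P[kx kJ] ->]; rewrite e_sym.
  apply: contraR kx => nek; rewrite -in_set1 -rowi !inE mxE.
  by rewrite kJ.
apply/negP => /in_Star/(_ _ (imset_f _ xJ)).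
by rewrite e_sym (negbTE nadj).
Qed.

(* The last conclusion is what lets the induction along the chain add a column. *)
Lemma path_independent (A : {set V}) (t : seq {set V}) :
  all [in Fl e] (A :: t) -> path <%O%O A t ->
  exists J : {set 'I_#|V|}, [/\ #|J| = size t, independent columns J &
    forall j, j \in J -> A \subset star e (enum_val j)].
Proof.
elim: t A => [|B t IH] A.
  exists set0; split; [by rewrite cards0 | | by move=> j; rewrite inE].
  by apply/independentP => K; rewrite subset0 => /eqP-> /eqP.
case/andP=> /imsetP[W _ AW] BtF /= /andP[ltAB pt].
have [J [cJ /independentP indJ BJ]] := IH B BtF pt.
have /properP[sAB [y yB]] : A \proper B by exact: ltAB.
rewrite {1}AW => /bigcapP yW.
have [w wW] : exists2 w, w \in W & y \notin star e w.
  apply/exists_inP; apply: contra_notT yW => /exists_inPn H w /H.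
  by rewrite negbK.
rewrite -(enum_rankK w) => nyx; pose x := enum_rank w.
(* Every vertex indexed by [J] is adjacent to all of [B], hence to [y]; the vertex of [x] is not. *)
have xJ : x \notin J.
  by apply: contra nyx => /BJ /subsetP; apply.
exists (x |: J); split; first by rewrite cardsU1 xJ cJ.
  apply/independentP => K sK K0.
  (* If [x] is in [K], row [y] is the required one: it is 0 on all of [J] and 1 at [x]. Otherwise
     [K] lies in [J]. *)
  have [xK|xK] := boolP (x \in K); last first.
    apply: indJ => //; apply/subsetP => k kK.
    have /setU1P[kx|//] := subsetP sK k kK.
    by rewrite -kx kK in xK.
  exists (enum_rank y); apply/cards1P; exists x; apply/setP => k.
  rewrite !inE mxE enum_rankK e_sym.
  have [->|kx] := eqVneq k x; first by move: nyx; rewrite xK inE.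
  apply/negbTE/andP => -[/(subsetP sK)/setU1P[/eqP|/BJ /subsetP/(_ y yB)]].
    by rewrite (negbTE kx).
  by rewrite inE => ->.
move=> j /setU1P[-> | /BJ]; last exact: subset_trans.
by rewrite enum_rankK AW; exact: bigcap_inf.
Qed.

End ComplementRank.

Theorem theorem3p3 (V : finType) (e : rel V)
  (e_sym : symmetric e) (e_irr : irreflexive e) :
  sb_rank (compl_adj e) = height (Fl e).
Proof.
apply/eqP; rewrite eqn_leq; apply/andP; split.
  apply/bigmax_leqP => J /(independent_path e_sym)[t [st tF pt]].
  have chainJ : has_chain (Fl e) #|J|.
    apply/has_chain_pathP; exists (Star e (enum_val @: J)), t.
    by rewrite /= Star_in_Fl.
  exact: (leq_bigmax_cond (Ordinal (has_chain_ltn_card chainJ))).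
apply/bigmax_leqP => k /has_chain_pathP[A [t [<- tF pt]]].
have [J [<- indJ _]] := path_independent e_sym tF pt.
exact: (leq_bigmax_cond J).
Qed.
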